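(* Let $n\geq 3$ and let $T_n$ be a tree with $n$ edges that is neither a path nor a star. Let $P_n$ be the path with $n$ edges and $S_n$ the star with $n$ edges. Then $$q(S_n)<q(T_n)<q(P_n).$$
   Context: For a finite simple graph $G=(V,E)$, associate a variable $x_v$ over $\mathbb{F}_2$ with each vertex $v$. A randomly generated system on $G$ has, for each edge $vw\in E$, one equation $f_{vw}(x_v,x_w)=0$, where the $f_{vw}$ are chosen independently and uniformly at random among all $16$ Boolean polynomials over $\mathbb{F}_2$ in the two variables $x_v,x_w$ (equivalently, all functions $\mathbb{F}_2^2\to\mathbb{F}_2$). $q(G)$ denotes the probability that this system is consistent, i.e. has a solution in $\mathbb{F}_2^{V}$. *)

(* Defs.v *)
From mathcomp Require Import all_boot all_order all_algebra.
Set Implicit Arguments.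
Unset Strict Implicit.
Unset Printing Implicit Defensive.
Import Order.TTheory GRing.Theory Num.Theory.

Record sgraph := SGraph {
  vertex :> finType;
  adj : rel vertex;
  adj_sym : symmetric adj;
  adj_irr : irreflexive adj
}.

(* The order on vertices given by [enum_rank] is used to pick exactly one
   ordered pair (v, w) for each unordered edge vw.                           *)
Definition edges (G : sgraph) : {set G * G} :=
  [set p | adj p.1 p.2 & enum_rank p.1 < enum_rank p.2].

Definition edge (G : sgraph) := {p : G * G | p \in edges G}.

Definition isomorphic (G H : sgraph) : Prop :=
  exists2 h : G -> H, bijective h & forall x y, adj (h x) (h y) = adj x y.

Definition connected (G : sgraph) : Prop :=
  0 < #|G| /\ forall x y : G, connect (@adj G) x y.

(* A cycle has at least three vertices: [ucycle] also holds of [:: v; w] for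
   adjacent v and w, and of the empty sequence.                              *)
Definition acyclic (G : sgraph) : Prop :=
  forall c : seq G, 2 < size c -> ~ ucycle (@adj G) c.

Definition is_tree (G : sgraph) : Prop := connected G /\ acyclic G.

Definition path_adj n : rel 'I_n.+1 :=
  fun i j => (i.+1 == j :> nat) || (j.+1 == i :> nat).

Lemma path_adj_sym n : symmetric (@path_adj n).
Proof. by move=> i j; rewrite /path_adj orbC. Qed.

Lemma path_adj_irr n : irreflexive (@path_adj n).
Proof. by move=> i; rewrite /path_adj orbb gtn_eqF. Qed.

Definition path_graph n := SGraph (@path_adj_sym n) (@path_adj_irr n).

Definition star_adj n : rel 'I_n.+1 :=
  fun i j => (i == ord0) (+) (j == ord0).

Lemma star_adj_sym n : symmetric (@star_adj n).
Proof. by move=> i j; rewrite /star_adj addbC. Qed.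

Lemma star_adj_irr n : irreflexive (@star_adj n).
Proof. by move=> i; rewrite /star_adj addbb. Qed.

Definition star_graph n := SGraph (@star_adj_sym n) (@star_adj_irr n).

(* Boolean polynomials in two variables over F_2, reduced modulo x ^ 2 = x,
   are identified with the 16 functions F_2 ^ 2 -> F_2 they induce.          *)
Definition system (G : sgraph) :=
  {ffun edge G -> {ffun 'F_2 * 'F_2 -> 'F_2}}.

Definition is_solution (G : sgraph) (f : system G) (x : {ffun G -> 'F_2}) :=
  [forall e : edge G, f e (x (val e).1, x (val e).2) == 0%R].

Definition consistent (G : sgraph) (f : system G) :=
  [exists x, is_solution f x].

(* Choosing the f_e independently and uniformly amounts to the uniform
   distribution on systems.                                                  *)
Definition q (G : sgraph) : rat :=
  (#|[set f : system G | consistent f]|%:R / #|{: system G}|%:R)%R.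

(* Main.v *)
(* Root a tree; the set S of values of the root variable extending to a solution
   is random, and its law is given by s = P(a \in S), for either value a, and
   t = P(S is everything). Gluing two trees at their roots multiplies s and t
   componentwise, and hanging a tree from a new root through an edge is the
   linear map (s, t) |-> (s - t / 4, s / 2 + t / 16). The consistency probability
   is 2 s - t, and this linear map is self-adjoint for the form
   2 s s' - t t', which reflects the freedom to choose the root.

   Cutting an edge writes the consistency probability as a pairing of the data of
   the two sides, which is increasing in s and 2 s - t of each side. By induction
   both are least for a star rooted at its center and greatest for a path rooted
   at an end, with s attaining its bound only there. What remains is to compare
   two stars joined at their centers with a star, and two paths glued at their
   ends. *)
Require Import Defs.
From mathcomp Require Import all_boot all_order all_algebra.
From mathcomp Require Import ring lra.
Set Implicit Arguments.
Unset Strict Implicit.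
Unset Printing Implicit Defensive.
Import Order.TTheory GRing.Theory Num.Theory.

(** * The recursion for rooted trees and its monotonicity *)

Section Gluing.
Local Open Scope ring_scope.

(* Join B C adds an edge between the roots of B and C, and keeps the root of B. *)
Inductive btree := Leaf | Join of btree & btree.

Fixpoint bsize A : nat := if A is Join B C then (bsize B + bsize C).+1 else 0.

(* For the random set S of the values of the root that extend to a solution,
   P(a \in S) is the same for both a; the pair is (P(a \in S), P(S is everything)). *)
Fixpoint feas_prob A : rat * rat :=
  if A is Join B C then
    let v := feas_prob B in let w := feas_prob C in
    (v.1 * (w.1 - w.2 / 4), v.2 * (w.1 / 2 + w.2 / 16))
  else (1, 1).

Definition sprob A := (feas_prob A).1.
Definition tprob A := (feas_prob A).2.
Definition bq A := 2 * sprob A - tprob A.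

Lemma sprobJ B C : sprob (Join B C) = sprob B * (sprob C - tprob C / 4).
Proof. by []. Qed.

Lemma tprobJ B C : tprob (Join B C) = tprob B * (sprob C / 2 + tprob C / 16).
Proof. by []. Qed.

Lemma tprob_bounds A : 0 < tprob A <= sprob A.
Proof.
elim: A => [|B /andP[B0 BS] C /andP[C0 CS]] //; rewrite sprobJ tprobJ.
apply/andP; split; first by apply: mulr_gt0 => //; lra.
by apply: ler_pM => //; lra.
Qed.

Lemma tprob_gt0 A : 0 < tprob A.
Proof. by case/andP: (tprob_bounds A). Qed.

Lemma tprob_le A : tprob A <= sprob A.
Proof. by case/andP: (tprob_bounds A). Qed.

Lemma sprob_gt0 A : 0 < sprob A.
Proof. exact: lt_le_trans (tprob_gt0 A) (tprob_le A). Qed.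

(** As [t <= s], the gap between [s - t / 4] and [s / 2 + t / 16] is positive. Hence [t = s] singles
    out the one-vertex tree. *)
Lemma tprob_ltJ B C : tprob (Join B C) < sprob (Join B C).
Proof.
rewrite sprobJ tprobJ; have := tprob_bounds B; have := tprob_bounds C.
move=> /andP[C0 CS] /andP[B0 BS].
have h : tprob B * (sprob C / 2 + tprob C / 16)
       < tprob B * (sprob C - tprob C / 4) by rewrite ltr_pM2l //; lra.
by apply: lt_le_trans h _; rewrite ler_pM2r //; lra.
Qed.

(* The tree glued from A and a rooted tree with probabilities (S, T) has
   consistency probability 2 * S * s - T * t. As (S, T) = T (1, 1) + (S - T) (1, 0),
   comparing bq and sprob is enough to compare all these gluings. *)
Lemma glue_decomp (S T s t : rat) :
  2 * (S * s) - T * t = T * (2 * s - t) + 2 * ((S - T) * s).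
Proof. by ring. Qed.

Lemma bqJ B C :
  bq (Join B C) = 2 * ((sprob C - tprob C / 4) * sprob B)
                  - (sprob C / 2 + tprob C / 16) * tprob B.
Proof. by rewrite /bq sprobJ tprobJ; ring. Qed.

(* Moving the root along the edge of Join. *)
Lemma bqJ_sym B C : bq (Join B C) = bq (Join C B).
Proof. by rewrite !bqJ; field. Qed.

(** After the decomposition both weights, [T] and [2 (S - T)], are positive, so equality of the sums
    forces equality of both terms. *)
Lemma glue_le (S T s t s' t' : rat) :
  0 < T -> T < S -> s <= s' -> 2 * s - t <= 2 * s' - t' ->
  2 * (S * s) - T * t <= 2 * (S * s') - T * t'
  ?= iff (s == s') && (2 * s - t == 2 * s' - t').
Proof.
move=> T0 TS hs hq; rewrite !glue_decomp andbC.
apply: leifD; first by rewrite /Order.leif ler_pM2l // (can_eq (mulKf (lt0r_neq0 T0))).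
have S0 : 0 < 2 * (S - T) by lra.
by rewrite !mulrA /Order.leif ler_pM2l // (can_eq (mulKf (lt0r_neq0 S0))).
Qed.

(** One side is replaced at a time: by [bqJ] the other side supplies weights with [0 < T < S], and
    [bqJ_sym] exchanges the sides. *)
Lemma bqJ_le B C B' C' :
  sprob B <= sprob B' -> bq B <= bq B' -> sprob C <= sprob C' -> bq C <= bq C' ->
  bq (Join B C) <= bq (Join B' C') ?= iff
    [&& sprob B == sprob B', bq B == bq B', sprob C == sprob C' & bq C == bq C'].
Proof.
have aux X Y Z : sprob X <= sprob Y -> bq X <= bq Y ->
    bq (Join X Z) <= bq (Join Y Z) ?= iff (sprob X == sprob Y) && (bq X == bq Y).
  move=> hs hq; rewrite !bqJ.
  have := tprob_gt0 Z; have := tprob_le Z.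
  by move=> h1 h2; apply: glue_le => //; lra.
move=> sB qB sC qC; rewrite andbA.
apply: leif_trans (aux _ _ C sB qB) _.
by rewrite bqJ_sym (bqJ_sym B'); exact: aux.
Qed.

(** * Stars as minimizers *)

Fixpoint bstar k := if k is k'.+1 then Join (bstar k') Leaf else Leaf.

Lemma sprob_starS k : sprob (bstar k.+1) = sprob (bstar k) * (3 / 4).
Proof. by []. Qed.

(** The two values of the center read disjoint entries of the equations, so their feasibilities are
    independent; for one edge this is [9 / 16 = (3 / 4) ^ 2]. *)
Lemma tprob_star k : tprob (bstar k) = sprob (bstar k) * sprob (bstar k).
Proof.
elim: k => [|k IH]; first by rewrite /sprob mulr1.
by rewrite sprob_starS /= tprobJ IH /sprob /tprob /=; field.
Qed.

Lemma sprob_starD b c : sprob (bstar (b + c)) = sprob (bstar b) * sprob (bstar c).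
Proof. by elim: b => [|b IH]; rewrite ?mul1r // addSn !sprob_starS IH mulrAC. Qed.

Lemma sprob_star_le1 k : sprob (bstar k) <= 1 ?= iff (k == 0).
Proof.
elim: k => [|k IH]; first exact: leif_refl.
have h : sprob (bstar k.+1) < 1.
  by rewrite sprob_starS; have [] := IH; have := sprob_gt0 (bstar k); lra.
by split; [exact: ltW | rewrite lt_eqF].
Qed.

(** From [t <= s], each join costs a factor [s - t / 4 >= s * 3 / 4]. *)
Lemma sprob_ge_star A : sprob (bstar (bsize A)) <= sprob A.
Proof.
elim: A => // B IHB C IHC; rewrite [bsize _]/= sprob_starS sprob_starD sprobJ -mulrA.
have := tprob_le C; have := sprob_gt0 (bstar (bsize C)).
have := sprob_gt0 (bstar (bsize B)) => B0 C0 CS.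
by apply: ler_pM IHB _; lra.
Qed.

(** Equality makes [B] extremal, hence a star, and forces [t = s] for [C], hence [C] is a single
    vertex by [tprob_ltJ]. *)
Lemma sprob_eq_star A : sprob (bstar (bsize A)) = sprob A -> A = bstar (bsize A).
Proof.
elim: A => // B IHB C IHC; have hB := sprob_ge_star B; have hC := sprob_ge_star C.
have B0 := sprob_gt0 (bstar (bsize B)); have C0 := tprob_le C.
have sC0 := sprob_gt0 (bstar (bsize C)).
rewrite {1}[bsize _]/= sprob_starS sprob_starD sprobJ -mulrA => /eqP.
have h : sprob (bstar (bsize C)) * (3 / 4) <= sprob C - tprob C / 4 by lra.
have [hB'|hB'] := eqVneq (sprob (bstar (bsize B))) (sprob B); last first.
  rewrite lt_eqF //.
  apply: lt_le_trans (_ : _ < sprob B * (sprob (bstar (bsize C)) * (3 / 4))) _.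
    by rewrite ltr_pM2r ?lt_neqAle ?hB' //; lra.
  by rewrite ler_pM2l //; lra.
case: C {IHC} hC C0 sC0 h => [|C1 C2] hC C0 sC0 h.
  by rewrite /= addn0 -(IHB hB').
have CS := tprob_ltJ C1 C2; have sB := sprob_gt0 B.
by rewrite hB' lt_eqF // ltr_pM2l //; lra.
Qed.

(** With [x] and [y] the values of [sprob] on the two stars, the gap is [x y (1 - x) (1 - y) / 2],
    which vanishes only if one star is a single vertex. *)
Lemma double_star_ge b c :
  bq (bstar (b + c).+1) <= bq (Join (bstar b) (bstar c)) ?= iff (b == 0) || (c == 0).
Proof.
rewrite bqJ /bq !tprob_star sprob_starS sprob_starD.
have [] := (sprob_star_le1 b, sprob_star_le1 c).
have := sprob_gt0 (bstar b); have := sprob_gt0 (bstar c).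
move: (sprob _) (sprob _) => x y y0 x0 [x1 <-] [y1 <-]; split; last first.
  rewrite eq_sym -subr_eq0 (_ : _ - _ = x * y * (1 - x) * (1 - y) / 2); last by field.
  rewrite mulf_eq0 invr_eq0 [2 == _]gt_eqF // orbF.
  rewrite !mulf_eq0 !subr_eq0 (gt_eqF x0) (gt_eqF y0) /=.
  by rewrite (eq_sym x) (eq_sym y).
rewrite -subr_ge0 (_ : _ - _ = x * y * (1 - x) * (1 - y) / 2); last by field.
by rewrite mulr_ge0 ?mulr_ge0 ?subr_ge0 ?(ltW x0) ?(ltW y0).
Qed.

Lemma bq_ge_star A : bq (bstar (bsize A)) <= bq A.
Proof.
elim: A => // B IHB C IHC.
apply: le_trans (double_star_ge _ _) _.
by apply: bqJ_le => //; exact: sprob_ge_star.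
Qed.

Lemma bq_eq_star B C :
  bq (bstar (bsize (Join B C))) = bq (Join B C) ->
  [/\ B = bstar (bsize B), C = bstar (bsize C) & (bsize B == 0) || (bsize C == 0)].
Proof.
move=> /eqP; have h1 := double_star_ge (bsize B) (bsize C).
have h2 := bqJ_le (sprob_ge_star B) (bq_ge_star B) (sprob_ge_star C) (bq_ge_star C).
rewrite (leif_trans h1 h2) => /andP[h /and4P[/eqP hB _ /eqP hC _]].
by split=> //; exact: sprob_eq_star.
Qed.

(** * Paths as maximizers *)

Fixpoint bpath k := if k is k'.+1 then Join Leaf (bpath k') else Leaf.

Lemma sprob_pathS k : sprob (bpath k.+1) = sprob (bpath k) - tprob (bpath k) / 4.
Proof. by rewrite /= sprobJ mul1r. Qed.

Lemma tprob_pathS k :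
  tprob (bpath k.+1) = sprob (bpath k) / 2 + tprob (bpath k) / 16.
Proof. by rewrite /= tprobJ mul1r. Qed.

(** Self-adjointness of the edge map lets the gluing vertex slide along the path, one edge per
    induction step. *)
Lemma bq_glue_paths a b :
  2 * (sprob (bpath a) * sprob (bpath b)) - tprob (bpath a) * tprob (bpath b)
  = bq (bpath (a + b)).
Proof.
elim: a b => [|a IH] b; first by rewrite /bq /sprob /tprob /= !mul1r.
rewrite addSnnS -IH !sprob_pathS !tprob_pathS; by field.
Qed.

(* With d the difference below, bq_glue_paths gives
   t (k + b) = t k * t b + 2 * d k, whence the recurrence for d. *)
Lemma sprob_path_superadd a b :
  sprob (bpath a.+1) * sprob (bpath b.+1) < sprob (bpath (a.+1 + b.+1)).
Proof.
pose d k := sprob (bpath (k + b.+1)) - sprob (bpath k) * sprob (bpath b.+1).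
have dS k : d k.+1 = d k / 2
    + tprob (bpath k) * (sprob (bpath b.+1) - tprob (bpath b.+1)) / 4.
  rewrite /d addSn (sprob_pathS (k + _)) (sprob_pathS k).
  have := bq_glue_paths k b.+1; rewrite /bq.
  move: (sprob _) (sprob _) (sprob _) (tprob _) (tprob _) (tprob _) => x y z u v w.
  by move=> h; lra.
have inc k : 0 < tprob (bpath k) * (sprob (bpath b.+1) - tprob (bpath b.+1)) / 4.
  by rewrite !mulr_gt0 ?tprob_gt0 // subr_gt0 tprob_ltJ.
rewrite -subr_gt0 -/(d a.+1).
elim: a => [|a IH]; rewrite dS.
  by rewrite {1}/d add0n mul1r subrr mul0r add0r.
by rewrite addr_gt0 // divr_gt0.
Qed.

Lemma sprob_pathD_ge a b :
  sprob (bpath a) * sprob (bpath b) <= sprob (bpath (a + b))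
  ?= iff (a == 0) || (b == 0).
Proof.
case: a => [|a]; first by rewrite mul1r; exact: leif_refl.
case: b => [|b]; first by rewrite addn0 mulr1; exact: leif_refl.
by split; [exact/ltW/sprob_path_superadd | rewrite lt_eqF ?sprob_path_superadd].
Qed.

(** This form is increasing in both quantities that the induction of [path_max] controls, unlike
    [s - t / 4], which decreases in [t]. *)
Lemma sprobJ_bq B C : sprob (Join B C) = sprob B * (sprob C / 2 + bq C / 4).
Proof. by rewrite sprobJ /bq; congr (_ * _); field. Qed.

Lemma path_max A :
  sprob A <= sprob (bpath (bsize A)) /\ bq A <= bq (bpath (bsize A)).
Proof.
elim: A => // B [sB qB] C [sC qC]; split; last first.
  apply: le_trans (bqJ_le sB qB sC qC) _.
  (* An edge between two path ends amounts to gluing one path to the other lengthened by that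
     edge. *)
  by rewrite bqJ -!(sprob_pathS, tprob_pathS) bq_glue_paths addSn addnC.
rewrite sprobJ_bq [bsize _]/= -addnS; apply: le_trans (sprob_pathD_ge _ _).
rewrite ler_pM ?(ltW (sprob_gt0 B)) //.
  by rewrite /bq; have := tprob_le C; have := tprob_gt0 C; lra.
by rewrite sprob_pathS; move: qC; rewrite {2}/bq; lra.
Qed.

Lemma sprob_eq_path A : sprob A = sprob (bpath (bsize A)) -> A = bpath (bsize A).
Proof.
elim: A => // B _ C IHC; have [sB _] := path_max B; have [sC qC] := path_max C.
have hC : sprob C / 2 + bq C / 4 <= sprob (bpath (bsize C).+1).
  by rewrite sprob_pathS; move: qC; rewrite {2}/bq; lra.
have C0 : 0 < sprob C / 2 + bq C / 4.
  by rewrite /bq; have := tprob_le C; have := tprob_gt0 C; lra.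
rewrite sprobJ_bq {1}[bsize _]/= -addnS => e.
have h1 : sprob B * (sprob C / 2 + bq C / 4)
          <= sprob (bpath (bsize B)) * (sprob C / 2 + bq C / 4).
  by rewrite ler_pM2r.
have h2 : sprob (bpath (bsize B)) * (sprob C / 2 + bq C / 4)
          <= sprob (bpath (bsize B)) * sprob (bpath (bsize C).+1).
  by rewrite ler_pM2l ?sprob_gt0.
have [h3 h4] := sprob_pathD_ge (bsize B) (bsize C).+1.
have /eqP : sprob (bpath (bsize B)) * sprob (bpath (bsize C).+1)
    = sprob (bpath (bsize B + (bsize C).+1)).
  by apply/eqP; rewrite eq_le h3 -e (le_trans h1 h2).
(* Superadditivity is strict for two paths of positive length and the second has length
   [(bsize C).+1], so [B] is a single vertex. *)
rewrite h4 orbF => B0; case: B B0 {sB} e h1 h2 h3 h4 => // _.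
rewrite mul1r [bsize Leaf]/= add0n => e _ _ _ _.
by rewrite /= -IHC //; move: qC e; rewrite sprob_pathS {2}/bq; lra.
Qed.

(** The sizes stay unconstrained, since two paths joined at their ends always form a path. *)
Lemma bq_eq_path B C :
  bq (Join B C) = bq (bpath (bsize (Join B C))) ->
  B = bpath (bsize B) /\ C = bpath (bsize C).
Proof.
have [[sB qB] [sC qC]] := (path_max B, path_max C).
rewrite [bsize _]/= -addSn -bq_glue_paths sprob_pathS tprob_pathS.
rewrite -bqJ [RHS]bqJ_sym => /eqP.
rewrite (bqJ_le sB qB sC qC) => /and4P[/eqP hB _ /eqP hC _].
by split; apply: sprob_eq_path.
Qed.

End Gluing.

(** * Tree shapes inside graphs *)

Fixpoint tree_on (G : sgraph) (A : btree) (r : G) (W : {set G}) : Prop :=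
  if A is Join B C then
    exists D E w, [/\ W = D :|: E, [disjoint D & E], tree_on B r D, tree_on C w E
      & {in D & E, forall x y, adj x y = (x == r) && (y == w)}]
  else W = [set r].

Lemma tree_on_root (G : sgraph) A (r : G) W : tree_on A r W -> r \in W.
Proof.
elim: A r W => [|B IHB C _] r W /=; first by move->; rewrite set11.
by case=> [D [E [w [-> _ /IHB rD _ _]]]]; rewrite inE rD.
Qed.

Lemma card_tree_on (G : sgraph) A (r : G) W : tree_on A r W -> #|W| = (bsize A).+1.
Proof.
elim: A r W => [|B IHB C IHC] r W /=; first by move->; rewrite cards1.
case=> [D [E [w [-> DE /IHB hD /IHC hE _]]]].
by rewrite cardsU (disjoint_setI0 DE) cards0 subn0 hD hE addnS.
Qed.

(** Paths are confined to [W] so that a vertex outside [W] can later close one into a cycle. *)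
Lemma tree_on_connect (G : sgraph) A (r : G) W :
  tree_on A r W ->
  {in W &, forall x y, connect [rel u v | [&& adj u v, u \in W & v \in W]] x y}.
Proof.
pose e (W : {set G}) := [rel u v | [&& adj u v, u \in W & v \in W]].
have eS (D E : {set G}) : D \subset E -> subrel (connect (e D)) (connect (e E)).
  move=> /subsetP DE; apply: connect_sub => x y /and3P[xy xD yD].
  by apply: connect1; rewrite /= xy !DE.
have esym D : connect_sym (e D).
  by apply: sym_connect_sym => x y /=; rewrite adj_sym (andbC (x \in _)).
suff main : tree_on A r W -> {in W, forall x, connect (e W) r x}.
  by move=> /main h x y /h rx /h; apply: connect_trans; rewrite esym.
elim: A r W => [|B IHB C IHC] r W /=; first by move=> -> x /set1P->; exact: connect0.
case=> [D [E [w [-> _ hB hC DE]]]] x.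
have rD := tree_on_root hB; have wE := tree_on_root hC.
case/setUP => [/(IHB _ _ hB)|/(IHC _ _ hC)]; first by apply: eS; apply: subsetUl.
move=> wx; apply: connect_trans (eS _ _ (subsetUr D E) _ _ wx).
by apply: connect1; rewrite /= !inE rD wE orbT DE // !eqxx.
Qed.

(** Two distinct neighbours of [v] are linked by a simple path inside [W], which [v] completes to a
    cycle. *)
Lemma tree_on_nbr_unique (G : sgraph) A (r : G) W u u' v :
  acyclic G -> tree_on A r W -> v \notin W ->
  u \in W -> u' \in W -> adj v u -> adj v u' -> u = u'.
Proof.
move=> acG /tree_on_connect cW vW uW u'W vu vu'; apply/eqP/negPn/negP => uu'.
have /connectP[p0 up0 e0] := cW _ _ uW u'W.
case/shortenP: up0 e0 => p up Up _ e0.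
case: p up Up e0 => [|a p] up Up e0; first by rewrite e0 eqxx in uu'.
have adjp s x : path [rel u v | [&& adj u v, u \in W & v \in W]] x s ->
    path (@adj G) x s /\ {subset s <= W}.
  elim: s x => //= y s IH x /andP[/and3P[-> _ yW] /IH[-> sW]]; split=> // z.
  by rewrite inE => /predU1P[->|/sW].
have [pG pW] := adjp _ _ up.
apply: (acG (v :: u :: a :: p)) => //; apply/andP; split.
  by rewrite /= rcons_path vu andTb; move: e0 pG => /= <- /andP[-> ->]; rewrite adj_sym.
rewrite cons_uniq Up andbT inE negb_or; apply/andP; split.
  by apply: contraNneq vW => ->.
by apply: contraNN vW => /pW.
Qed.

(** The new leaf goes into the piece containing its neighbour [u], down to a one-vertex piece, where
    a [Join] is created. *)
Lemma tree_on_grow (G : sgraph) A (r : G) W u v :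
  tree_on A r W -> v \notin W -> u \in W ->
  {in W, forall x, adj x v = (x == u)} -> exists A', tree_on A' r (v |: W).
Proof.
elim: A r W => [|B IHB C IHC] r W /=.
  move=> -> vr /set1P-> huv; exists (Join Leaf Leaf), [set r], [set v], v.
  split=> //; first by rewrite setUC.
    by rewrite disjoints1 inE eq_sym; rewrite inE in vr.
  by move=> x y xr /set1P->; rewrite huv // eqxx andbT.
case=> [D [E [w [-> DE hB hC aDE]]]]; rewrite inE negb_or => /andP[vD vE] uW huv.
have rD := tree_on_root hB; have wE := tree_on_root hC.
have hD : {in D, forall x, adj x v = (x == u)}.
  by move=> x xD; apply: huv; rewrite inE xD.
have hE : {in E, forall x, adj x v = (x == u)}.
  by move=> x xE; apply: huv; rewrite inE xE orbT.
have neqDE x y : x \in D -> y \in E -> (y == x) = false.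
  by move=> xD yE; apply: contraTF yE => /eqP->; rewrite (disjointFr DE xD).
have neqv (F : {set G}) x : v \notin F -> x \in F -> (v == x) = false.
  by move=> vF xF; apply: contraNF vF => /eqP->.
case/setUP: uW => [uD|uE].
  have [B' hB'] := IHB _ _ hB vD uD hD.
  exists (Join B' C), (v |: D), E, w; split=> //; first by rewrite setUA.
    by rewrite disjoints_subset subUset sub1set -disjoints_subset inE vE.
  move=> x y /setU1P[->|xD] yE; last exact: aDE.
  by rewrite adj_sym hE // (neqv D r) // neqDE.
have [C' hC'] := IHC _ _ hC vE uE hE.
exists (Join B C'), D, (v |: E), w; split=> //; first by rewrite setUCA.
  rewrite disjoint_sym disjoints_subset subUset sub1set -disjoints_subset.
  by rewrite inE vD disjoint_sym.
move=> x y xD /setU1P[->|yE]; last exact: aDE.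
by rewrite hD // (neqv E w) // andbF eq_sym neqDE.
Qed.

(** [W] grows by one vertex at a time: connectedness gives an edge leaving [W], and acyclicity makes
    it the only edge from [W] to its outer end. *)
Lemma tree_ex_tree_on (G : sgraph) :
  is_tree G -> exists A (r : G), tree_on A r [set: G].
Proof.
case=> [[G0 cG] acG].
suff grow k : k < #|G| -> exists A (r : G) W, tree_on A r W /\ #|W| = k.+1.
  have [|A [r [W [h cW]]]] := grow #|G|.-1; first by rewrite prednK.
  exists A, r; suff -> : [set: G] = W by [].
  by apply/esym/eqP; rewrite eqEcard subsetT cardsT cW leqSpred.
elim: k => [_|k IH kG].
  by have /card_gt0P[r _] := G0; exists Leaf, r, [set r]; rewrite cards1.
have [A [r [W [h cW]]]] := IH (ltnW kG).
have [u [v [uW vW uv]]] : exists u v, [/\ u \in W, v \notin W & adj u v].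
  have /subsetPn[y _ yW] : ~~ ([set: G] \subset W).
    by apply: contraL kG => /subset_leq_card; rewrite cardsT cW -leqNgt.
  have [/existsP[u /existsP[v /and3P[uW vW uv]]]|/existsPn no] :=
    boolP [exists u, exists v, [&& u \in W, v \notin W & adj u v]].
    by exists u, v.
  have clW : closed (@adj G) W.
    apply: intro_closed => [|a b ab aW].
      by apply: sym_connect_sym; exact: adj_sym.
    by move/existsPn: (no a) => /(_ b); rewrite aW ab andbT negbK.
  by move: (closed_connect clW (cG r y)); rewrite (tree_on_root h) (negPf yW).
have huv : {in W, forall x, adj x v = (x == u)}.
  move=> x xW; apply/idP/eqP => [xv|-> //].
  by apply: (tree_on_nbr_unique acG h vW xW uW); rewrite adj_sym.
have [A' hA'] := tree_on_grow h vW uW huv.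
by exists A', r, (v |: W); rewrite cardsU1 vW cW.
Qed.

(** The maps of the two pieces are merged; as they send roots to roots, they preserve the bridge and
    the non-edges across. *)
Lemma tree_on_iso (G H : sgraph) A (r : G) (W : {set G}) (r' : H) (W' : {set H}) :
  tree_on A r W -> tree_on A r' W' ->
  exists h : G -> H, [/\ h r = r', h @: W = W',  {in W &, injective h}
    & {in W &, forall x y, adj (h x) (h y) = adj x y}].
Proof.
elim: A r W r' W' => [|B IHB C IHC] r W r' W' /=.
  move=> -> ->; exists (fun=> r'); split=> //; first by rewrite imset_set1.
    by move=> x y /set1P-> /set1P->.
  by move=> x y /set1P-> /set1P->; rewrite !adj_irr.
case=> [D [E [w [-> DE hB hC aDE]]]] [D' [E' [w' [-> DE' hB' hC' aDE']]]].
have [f [fr fD fI fA]] := IHB _ _ _ _ hB hB'.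
have [g [gw gE gI gA]] := IHC _ _ _ _ hC hC'.
pose h x := if x \in D then f x else g x.
have hD : {in D, h =1 f} by move=> x xD; rewrite /h xD.
have hE : {in E, h =1 g} by move=> x xE; rewrite /h (disjointFl DE xE).
have fD' x : x \in D -> f x \in D' by move=> xD; rewrite -fD imset_f.
have gE' x : x \in E -> g x \in E' by move=> xE; rewrite -gE imset_f.
have neq x y : x \in D -> y \in E -> f x <> g y.
  by move=> /fD' xD /gE' yE e; rewrite e (disjointFl DE' yE) in xD.
have rD := tree_on_root hB; have wE := tree_on_root hC.
have cross x y : x \in D -> y \in E -> adj (f x) (g y) = adj x y.
  move=> xD yE; rewrite aDE // aDE' ?fD' ?gE' // -fr -gw.
  by rewrite (inj_in_eq fI) // (inj_in_eq gI).
exists h; split.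
- by rewrite hD.
- by rewrite imsetU -fD -gE (eq_in_imset hD) (eq_in_imset hE).
- move=> x y /setUP[xD|xE] /setUP[yD|yE].
  + by rewrite hD ?hD //; exact: fI.
  + by rewrite hD ?hE // => /neq[].
  + by rewrite hE ?hD // => /esym/neq[].
  + by rewrite hE ?hE //; exact: gI.
- move=> x y /setUP[xD|xE] /setUP[yD|yE].
  + by rewrite !hD //; exact: fA.
  + by rewrite (hD x) ?(hE y) //; exact: cross.
  + by rewrite (hE x) ?(hD y) // adj_sym [RHS]adj_sym; exact: cross.
  + by rewrite !hE //; exact: gA.
Qed.

Lemma tree_on_isomorphic (G H : sgraph) A (r : G) (r' : H) :
  tree_on A r [set: G] -> tree_on A r' [set: H] -> isomorphic G H.
Proof.
move=> hG hH; have [h [_ hW hI hA]] := tree_on_iso hG hH.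
have inj : injective h by move=> x y; apply: hI; rewrite inE.
exists h => [|x y]; last by apply: hA; rewrite inE.
apply: inj_card_bij => //; rewrite -(cardsT G) -(cardsT H).
by rewrite (card_tree_on hG) (card_tree_on hH).
Qed.

(** * Edges of a tree cut at a bridge *)

Definition edges_in (G : sgraph) (W : {set G}) : {set edge G} :=
  [set e | ((val e).1 \in W) && ((val e).2 \in W)].

Lemma bridge_ex (G : sgraph) (u v : G) : adj u v ->
  exists e : edge G, val e = (u, v) \/ val e = (v, u).
Proof.
move=> uv; have [|vu] := ltnP (enum_rank u) (enum_rank v).
  move=> lt; have h : (u, v) \in edges G by rewrite inE uv.
  by exists (exist (fun p => p \in edges G) _ h); left.
have h : (v, u) \in edges G.
  rewrite inE /= adj_sym uv ltn_neqAle vu andbT /=.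
  by apply: contraTneq uv => /ord_inj/enum_rank_inj->; rewrite adj_irr.
by exists (exist (fun p => p \in edges G) _ h); right.
Qed.

Lemma edge_adj (G : sgraph) (e : edge G) : adj (val e).1 (val e).2.
Proof. by case: e => p /=; rewrite inE => /andP[]. Qed.

(** The order on ranks admits only one orientation of an edge. *)
Lemma edge_uniq (G : sgraph) (e e' : edge G) u v :
  val e = (u, v) \/ val e = (v, u) -> val e' = (u, v) \/ val e' = (v, u) -> e = e'.
Proof.
move=> he he'; apply: val_inj; have := valP e; have := valP e'; rewrite !inE.
by case: he he' => -> [] -> //= /andP[_ h] /andP[_ /(ltn_trans h)]; rewrite ltnn.
Qed.

Lemma edges_in_split (G : sgraph) (D E : {set G}) (r w : G) (e0 : edge G) :
  [disjoint D & E] -> r \in D -> w \in E ->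
  {in D & E, forall x y, adj x y = (x == r) && (y == w)} ->
  val e0 = (r, w) \/ val e0 = (w, r) ->
  [/\ edges_in (D :|: E) = e0 |: (edges_in D :|: edges_in E),
     e0 \notin edges_in D, e0 \notin edges_in E & [disjoint edges_in D & edges_in E]].
Proof.
move=> DE rD wE aDE he0.
have rE := disjointFr DE rD; have wD := disjointFl DE wE; split.
- apply/setP => e; rewrite !inE; apply/idP/idP; last first.
    case/predU1P=> [->|]; first by case: he0 => -> /=; rewrite rD wE !orbT.
    by case/orP=> /andP[-> ->]; rewrite ?orbT.
  have ee0 x y : x \in D -> y \in E -> val e = (x, y) \/ val e = (y, x) -> e = e0.
    move=> xD yE he; have : adj x y.
      by have := edge_adj e; case: he => -> //=; rewrite adj_sym.
    by rewrite aDE // => /andP[/eqP ex /eqP ey]; move: he; rewrite ex ey => /edge_uniq; apply.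
  case/andP=> /orP[h1|h1] /orP[h2|h2]; rewrite h1 h2 ?orbT //.
    by rewrite (ee0 _ _ h1 h2) ?eqxx //; left; case: (val e).
  by rewrite (ee0 _ _ h2 h1) ?eqxx //; right; case: (val e).
- by rewrite inE; case: he0 => -> /=; rewrite wD ?andbF.
- by rewrite inE; case: he0 => -> /=; rewrite rE ?andbF.
- apply/pred0P => e /=; rewrite !inE; apply/negP => /andP[/andP[h _] /andP[h' _]].
  by rewrite (disjointFr DE h) in h'.
Qed.

Lemma card_edges_in (G : sgraph) A (r : G) W : tree_on A r W -> #|edges_in W| = bsize A.
Proof.
elim: A r W => [|B IHB C IHC] r W /=.
  move=> ->; apply/eqP; rewrite cards_eq0; apply/eqP/setP => e; rewrite !inE.
  by apply: contraTF (edge_adj e) => /andP[/eqP-> /eqP->]; rewrite adj_irr.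
case=> [D [E [w [-> DE hB hC aDE]]]].
have rD := tree_on_root hB; have wE := tree_on_root hC.
have [|e0 he0] := @bridge_ex _ r w; first by rewrite aDE // !eqxx.
have [-> eD eE dDE] := edges_in_split DE rD wE aDE he0.
rewrite cardsU1 inE negb_or eD eE cardsU (disjoint_setI0 dDE) cards0 subn0.
by rewrite (IHB _ _ hB) (IHC _ _ hC).
Qed.

Lemma card_edge (G : sgraph) A (r : G) : tree_on A r [set: G] -> #|edges G| = bsize A.
Proof.
move=> h; rewrite -(card_edges_in h) -(card_sig (mem (edges G))) -cardsT.
by congr #|pred_of_set _|; apply/setP => e; rewrite !inE.
Qed.

(** * Shapes of the star and path graphs *)

Lemma tree_on_star n k (W : {set star_graph n}) :
  ord0 \in W -> #|W| = k.+1 -> tree_on (bstar k) (ord0 : star_graph n) W.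
Proof.
elim: k W => [|k IH] W W0 cW /=.
  by apply/esym/eqP; rewrite eqEcard sub1set W0 cards1 cW.
have /set0Pn[x /setD1P[x0 xW]] : W :\ ord0 != set0.
  by rewrite -card_gt0; move: cW; rewrite (cardsD1 ord0) W0 add1n => -[->].
exists (W :\ x), [set x], x; split=> //.
- by rewrite setUC setD1K.
- by rewrite disjoint_sym disjoints1 !inE eqxx.
- by apply: IH; rewrite ?inE ?W0 1?eq_sym ?x0 //; move: cW; rewrite (cardsD1 x) xW add1n => -[].
- by move=> y z _ /set1P->; rewrite /= /star_adj (negPf x0) addbF eqxx andbT.
Qed.

Lemma star_graph_center n :
  tree_on (bstar n) (ord0 : star_graph n) [set: star_graph n].
Proof. by apply: tree_on_star; rewrite ?inE // cardsT card_ord. Qed.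

(** With [star_graph_center], this covers both equality cases of [bq_eq_star]. *)
Lemma star_graph_leaf n :
  tree_on (Join Leaf (bstar n)) (ord_max : star_graph n.+1) [set: star_graph n.+1].
Proof.
exists [set ord_max], [set~ ord_max], ord0; split=> //.
- by rewrite setUCr.
- by rewrite disjoints1 !inE eqxx.
- apply: tree_on_star; rewrite ?inE //.
  by rewrite cardsC1 card_ord.
- by move=> x y /set1P->; rewrite !inE /= /star_adj eqxx => _.
Qed.

Lemma path_graph_up n k (i : path_graph n) : i + k = n ->
  tree_on (bpath k) i [set j : path_graph n | i <= j].
Proof.
elim: k i => [|k IH] i /= ik.
  apply/setP => j; rewrite !inE; rewrite addn0 in ik.
  by rewrite -(inj_eq val_inj) /= eqn_leq ik (_ : j <= n) // -ltnS.
have iS : i.+1 < n.+1 by have := leq_addr k i.+1; rewrite addSnnS ik ltnS.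
exists [set i], [set j : path_graph n | i.+1 <= j], (Ordinal iS); split=> //.
- by apply/setP => j; rewrite !inE leq_eqVlt -(inj_eq val_inj) eq_sym.
- by rewrite disjoints1 inE ltnn.
- by apply: (IH (Ordinal iS)); rewrite /= addSnnS.
- move=> x y /set1P->; rewrite inE eqxx /= /path_adj => iy.
  by rewrite -[RHS](inj_eq val_inj) /= [y.+1 == i]gtn_eqF ?orbF 1?[RHS]eq_sym // ltnW.
Qed.

Lemma path_graph_down n k (i : path_graph n) : k = i :> nat ->
  tree_on (bpath k) i [set j : path_graph n | j <= i].
Proof.
elim: k i => [|k IH] i /= ik.
  by apply/setP => j; rewrite !inE -ik leqn0 -(inj_eq val_inj) /= -ik.
have kS : k < n.+1 by apply: ltn_trans (ltn_ord i); rewrite -ik.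
exists [set i], [set j : path_graph n | j <= k], (Ordinal kS); split=> //.
- by apply/setP => j; rewrite !inE -val_eqE /= -ik leq_eqVlt ltnS.
- by rewrite disjoints1 inE -ik ltnn.
- exact: (IH (Ordinal kS)).
- move=> x y /set1P->; rewrite inE eqxx /= /path_adj -ik => yk.
  by rewrite -[RHS](inj_eq val_inj) /= [k.+2 == y]gtn_eqF // ltnS leqW.
Qed.

Lemma path_graph_end n :
  tree_on (bpath n) (ord0 : path_graph n) [set: path_graph n].
Proof.
by have := @path_graph_up n n ord0 (add0n n); congr tree_on.
Qed.

(** Cutting the edge between [b] and [b + 1] leaves a path down to [0] and a path up to the other
    end: the equality case of [bq_eq_path]. *)
Lemma path_graph_inner b c :
  tree_on (Join (bpath b) (bpath c)) (inord b : path_graph (b + c).+1)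
    [set: path_graph (b + c).+1].
Proof.
set n := (b + c).+1.
have hb : (inord b : 'I_n.+1) = b :> nat by rewrite inordK // !ltnS leqW // leq_addr.
have hc : (inord b.+1 : 'I_n.+1) = b.+1 :> nat by rewrite inordK // !ltnS leq_addr.
exists [set j : path_graph n | j <= (inord b : 'I_n.+1)],
       [set j : path_graph n | (inord b.+1 : 'I_n.+1) <= j], (inord b.+1); split.
- by apply/setP => j; rewrite !inE hb hc leqNgt orNb.
- by apply/pred0P => j /=; rewrite !inE hb hc leqNgt andNb.
- by apply: path_graph_down; rewrite hb.
- by apply: path_graph_up; rewrite hc.
- move=> x y; rewrite !inE hb hc /= /path_adj => xb yb.
  rewrite -!(inj_eq val_inj) /= hb hc; apply/idP/andP => [/orP[]/eqP e|[/eqP-> /eqP->]].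
  + have ex : x = b :> nat by apply/eqP; rewrite eqn_leq xb -ltnS e yb.
    by rewrite -e ex !eqxx.
  + by move: (leq_trans yb (leqnSn y)); rewrite e ltnNge xb.
  + by rewrite eqxx.
Qed.

(** * Random systems as tables of independent fair bits *)

Section Probability.
Local Open Scope ring_scope.
Variable G : sgraph.
Implicit Types (f g : system G) (F H : system G -> rat) (X : pred (system G)).
Implicit Types (i : edge G * ('F_2 * 'F_2)) (M : {set edge G * ('F_2 * 'F_2)}).

Definition Ex F : rat := (\sum_f F f) / #|{: system G}|%:R.
Definition Pr X : rat := Ex (fun f => (X f)%:R).

Lemma eq_Ex F H : F =1 H -> Ex F = Ex H.
Proof. by move=> e; rewrite /Ex; congr (_ / _); apply: eq_bigr. Qed.

Lemma eq_Pr X X' : X =1 X' -> Pr X = Pr X'.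
Proof. by move=> e; apply: eq_Ex => f; rewrite e. Qed.

Lemma ExD F H : Ex (fun f => F f + H f) = Ex F + Ex H.
Proof. by rewrite /Ex big_split mulrDl. Qed.

Lemma ExB F H : Ex (fun f => F f - H f) = Ex F - Ex H.
Proof. by rewrite /Ex sumrB mulrBl. Qed.

Lemma card_system_neq0 : #|{: system G}|%:R != 0 :> rat.
Proof. by rewrite pnatr_eq0 -lt0n; apply/card_gt0P; exists [ffun=> [ffun=> 0]]. Qed.

Lemma Pr_true : Pr xpredT = 1.
Proof. by rewrite /Pr /Ex sumr_const -mulr_natr mul1r divff // card_system_neq0. Qed.

Lemma PrE X : Pr X = #|[set f | X f]|%:R / #|{: system G}|%:R.
Proof.
rewrite /Pr /Ex -sum1_card natr_sum; congr (_ / _).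
rewrite [RHS]big_mkcond /=; apply: eq_bigr => f _.
by rewrite inE; case: (X f).
Qed.

(** A system is a table of bits indexed by an edge and an argument pair; [M] is a set of table
    entries. *)
Definition depends_on M X :=
  forall f g, {in M, forall i, f i.1 i.2 = g i.1 i.2} -> X f = X g.

Definition mix M f g : system G :=
  [ffun e => [ffun p => if (e, p) \in M then f e p else g e p]].

Lemma mixK M f g : mix M (mix M f g) (mix M g f) = f.
Proof.
apply/ffunP => e; rewrite ffunE; apply/ffunP => p; rewrite !ffunE.
by case: ifP => // ->.
Qed.

(* X f && Y g is X && Y at mix f g, and (f, g) |-> (mix f g, mix g f) is an involution. *)
Lemma Pr_indep M M' X Y : depends_on M X -> depends_on M' Y -> [disjoint M & M'] ->
  Pr (fun f => X f && Y f) = Pr X * Pr Y.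
Proof.
move=> dX dY MM'.
suff e : (\sum_f (X f)%:R) * (\sum_g (Y g)%:R)
       = (\sum_f (X f && Y f)%:R) * #|{: system G}|%:R :> rat.
  by rewrite /Pr /Ex mulrACA e mulrA mulfK ?card_system_neq0.
rewrite big_distrlr pair_bigA /=.
pose sw (p : system G * system G) := (mix M p.1 p.2, mix M p.2 p.1).
have swK : involutive sw by case=> f g; rewrite /sw /= !mixK.
rewrite (reindex_inj (inv_inj swK)) /=.
transitivity (\sum_(p : system G * system G) (X p.1 && Y p.1)%:R : rat).
  apply: eq_bigr => -[f g] _ /=; rewrite -natrM mulnb; congr (_ && _)%:R.
    by apply: dX => -[e p] iM; rewrite /mix !ffunE iM.
  apply: dY => -[e p] iM; rewrite /mix !ffunE.
  by rewrite (disjointFl MM' iM).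
rewrite -(pair_bigA _ (fun f _ => (X f && Y f)%:R)) /= big_distrl /=.
apply: eq_bigr => f _; by rewrite sumr_const [RHS]mulr_natr; congr (_ *+ _); exact: eq_card.
Qed.

Definition sat i f := f i.1 i.2 == 0.

Lemma depends_on_sat i : depends_on [set i] (sat i).
Proof. by move=> f g fg; rewrite /sat fg ?set11. Qed.

Lemma Pr_sat i : Pr (sat i) = 1 / 2.
Proof.
(* Flipping the entry [i] is an involution exchanging [sat i] with its negation. *)
pose flip f : system G := [ffun e => [ffun p => f e p + ((e, p) == i)%:R]].
have F2D (c : 'F_2) : c + 1 + 1 = c by rewrite -addrA (_ : 1 + 1 = 0) ?addr0 //; exact: val_inj.
have flipK : involutive flip.
  move=> f; apply/ffunP => e; rewrite ffunE; apply/ffunP => p; rewrite !ffunE.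
  by case: eqP => _; rewrite ?addr0.
have h : Pr (sat i) = Pr (fun f => ~~ sat i f).
  rewrite /Pr /Ex (reindex_inj (inv_inj flipK)) /=; congr (_ / _).
  apply: eq_bigr => f _; congr (nat_of_bool _)%:R.
  rewrite /sat !ffunE -surjective_pairing eqxx.
  by case: (f i.1 i.2) => -[|[|//]] ?.
have := Pr_true; rewrite -(eq_Pr (fun f => orbN (sat i f))).
rewrite (_ : Pr _ = Pr (sat i) + Pr (fun f => ~~ sat i f)); first by rewrite -h; lra.
by rewrite -ExD; apply: eq_Ex => f; case: (sat i f); rewrite ?addr0 ?add0r.
Qed.

Lemma Pr_all_sat M X s : depends_on M X -> uniq s -> [disjoint s & M] ->
  Pr (fun f => X f && all (sat^~ f) s) = Pr X / 2 ^+ size s.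
Proof.
move=> dX; elim: s => [|i s IH] /=.
  by rewrite expr0 divr1 => _ _; apply: eq_Pr => f; rewrite andbT.
case/andP=> i_s Us; rewrite disjoint_cons => /andP[iM sM].
rewrite exprSr invfM mulrA -IH //.
have dXs : depends_on (M :|: [set j in s]) (fun f => X f && all (sat^~ f) s).
  move=> f g fg; congr (_ && _).
    by apply: dX => j jM; rewrite fg // inE jM.
  by apply: eq_in_all => j js; rewrite /sat fg // !inE js orbT.
rewrite mulrC -[2^-1]mul1r -(Pr_sat i) mulrC -(Pr_indep dXs (@depends_on_sat i)).
  by apply: eq_Pr => f; rewrite andbAC andbA.
by rewrite disjoint_sym disjoints1 !inE negb_or iM.
Qed.
Lemma F2_ex (P : pred 'F_2) : [exists b, P b] = P 0 || P 1.
Proof.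
apply/existsP/orP => [[b Pb]|[P0|P1]]; [|by exists 0|by exists 1].
suff [<-|<-] : b = 0 \/ b = 1 by [left | right].
by case: b {Pb} => -[|[|//]] h; [left | right]; apply: val_inj.
Qed.

(** * Feasible root values and the recursion they satisfy *)

Definition feasible (r : G) (W : {set G}) (a : 'F_2) f :=
  [exists x : {ffun G -> 'F_2}, (x r == a) &&
    [forall e : edge G, (e \in edges_in W) ==> (f e (x (val e).1, x (val e).2) == 0)]].

Lemma feasibleP r W a f :
  reflect (exists2 x : {ffun G -> 'F_2}, x r = a
            & {in edges_in W, forall e, f e (x (val e).1, x (val e).2) = 0})
          (feasible r W a f).
Proof.
apply: (iffP existsP) => [[x /andP[/eqP xr /forallP h]]|[x xr h]]; exists x => //.
  by move=> e eW; apply/eqP; move: (h e); rewrite eW.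
by rewrite xr eqxx; apply/forallP => e; apply/implyP => /h ->.
Qed.

Lemma consistent_feasible r f :
  consistent f = feasible r setT 0 f || feasible r setT 1 f.
Proof.
rewrite -(F2_ex (fun a => feasible r setT a f)); apply/existsP/existsP.
  case=> x /forallP h; exists (x r); apply/feasibleP; exists x => // e _.
  exact/eqP.
case=> a /feasibleP[x _ h]; exists x; apply/forallP => e; apply/eqP.
by apply: h; rewrite !inE.
Qed.

Definition coords (W : {set G}) : {set edge G * ('F_2 * 'F_2)} :=
  [set i | i.1 \in edges_in W].

Lemma in_coords W i : (i \in coords W) = (i.1 \in edges_in W).
Proof. by rewrite in_set. Qed.

Lemma depends_on_feasible r W a : depends_on (coords W) (feasible r W a).
Proof.
have aux f g : {in coords W, forall i, f i.1 i.2 = g i.1 i.2} ->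
    feasible r W a f -> feasible r W a g.
  move=> fg /feasibleP[x xr h]; apply/feasibleP; exists x => // e eW.
  by rewrite -(fg (e, _)) ?in_coords //= h.
by move=> f g fg; apply/idP/idP; apply: aux => // i iW; rewrite fg.
Qed.

(* The coordinate of the equation on the edge e at x_r = a, x_w = b, where w is
   the other endpoint of e. *)
Definition at_edge (e : edge G) (r : G) (a b : 'F_2) : edge G * ('F_2 * 'F_2) :=
  (e, if (val e).1 == r then (a, b) else (b, a)).

Lemma at_edge_inj e r a b a' b' :
  (at_edge e r a b == at_edge e r a' b') = (a == a') && (b == b').
Proof.
by rewrite /at_edge xpair_eqE eqxx /=; case: ifP => _; rewrite xpair_eqE // andbC.
Qed.

(** Disjointness lets solutions on [D] and [E] be merged, and the bridge carries the only equation
    reading both. *)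
Lemma feasible_join (D E : {set G}) (r w : G) (e0 : edge G) a f :
  [disjoint D & E] -> r \in D -> w \in E ->
  {in D & E, forall x y, adj x y = (x == r) && (y == w)} ->
  val e0 = (r, w) \/ val e0 = (w, r) ->
  feasible r (D :|: E) a f = feasible r D a f &&
    [exists b, feasible w E b f && sat (at_edge e0 r a b) f].
Proof.
move=> DE rD wE aDE he0; have [eDE _ _ _] := edges_in_split DE rD wE aDE he0.
have wr : w != r by apply: contraTneq wE => ->; rewrite (disjointFr DE rD).
have sate0 (x : {ffun G -> 'F_2}) :
    sat (at_edge e0 r (x r) (x w)) f = (f e0 (x (val e0).1, x (val e0).2) == 0).
  by rewrite /sat /at_edge; case: he0 => -> /=; rewrite ?eqxx // (negPf wr).
apply/feasibleP/andP => [[x xr h]|[/feasibleP[x xr hx]]].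
  split; first by apply/feasibleP; exists x => // e eD; rewrite h // eDE !in_setU eD orbT.
  apply/existsP; exists (x w); apply/andP; split.
    by apply/feasibleP; exists x => // e eE; rewrite h // eDE !in_setU eE !orbT.
  by rewrite -xr sate0 h // eDE setU11.
case/existsP=> b /andP[/feasibleP[y yw hy] s0].
pose z := [ffun v => if v \in D then x v else y v] : {ffun G -> 'F_2}.
have zD v : v \in D -> z v = x v by rewrite ffunE => ->.
have zE v : v \in E -> z v = y v by move=> vE; rewrite ffunE (disjointFl DE vE).
exists z => [|e]; first by rewrite zD.
rewrite eDE => /setU1P[->|/setUP[] eW].
- by apply/eqP; rewrite -sate0 zD // zE // xr yw.
- by have := eW; rewrite inE => /andP[e1 e2]; rewrite !zD // hx.
- by have := eW; rewrite inE => /andP[e1 e2]; rewrite !zE // hy.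
Qed.

Lemma Pr_or X Y : Pr (fun f => X f || Y f) = Pr X + Pr Y - Pr (fun f => X f && Y f).
Proof.
rewrite -ExD -ExB; apply: eq_Ex => f; case: (X f) (Y f) => -[] /=.
all: by rewrite ?addrK ?subr0.
Qed.

Lemma Pr_feasible A r W : tree_on A r W ->
  (forall a, Pr (feasible r W a) = sprob A) /\
  Pr (fun f => feasible r W 0 f && feasible r W 1 f) = tprob A.
Proof.
elim: A r W => [|B IHB C IHC] r W /=.
  move=> ->; have h a f : feasible r [set r] a f.
    apply/feasibleP; exists [ffun=> a]; first by rewrite ffunE.
    move=> e; rewrite !inE => /andP[/eqP e1 /eqP e2].
    by have := edge_adj e; rewrite e1 e2 adj_irr.
  split=> [a|]; rewrite -[RHS]Pr_true; apply: eq_Pr => f; by rewrite !h.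
case=> [D [E [w [-> DE hB hC aDE]]]].
have rD := tree_on_root hB; have wE := tree_on_root hC.
have [|e0 he0] := @bridge_ex _ r w; first by rewrite aDE // !eqxx.
have [sB tB] := IHB _ _ hB; have [sC tC] := IHC _ _ hC.
have [eDE eD eE dDE] := edges_in_split DE rD wE aDE he0.
(* [U b] says that the value [b] of [w] extends over [E], and [L a] that some such [b] is compatible
   with [a] across the bridge. *)
pose U b f := feasible w E b f.
pose c a b := at_edge e0 r a b.
pose L a f := U 0 f && sat (c a 0) f || U 1 f && sat (c a 1) f.
have dU b : depends_on (coords E) (U b) by exact: depends_on_feasible.
have dUU : depends_on (coords E) (fun f => U 0 f && U 1 f).
  by move=> f g fg; rewrite (dU 0 f g) // (dU 1 f g).
pose M := coords E :|: [set i | i.1 == e0].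
have DM : [disjoint coords D & M].
  apply/pred0P => -[e p] /=; rewrite in_setU !in_coords [X in _ || X]in_set /=; apply/negP => /andP[eeD].
  by case/orP=> [eeE|/eqP ee0]; [rewrite (disjointFr dDE eeD) in eeE | rewrite -ee0 eeD in eD].
have dL a : depends_on M (L a).
  have cM b : c a b \in M by rewrite in_setU [X in _ || X]in_set eqxx orbT.
  have EM : {subset coords E <= M} by move=> i iE; rewrite in_setU iE.
  move=> f g fg; rewrite /L /sat !fg //; congr (_ && _ || _ && _).
    by apply: dU => i /EM; apply: fg.
  by apply: dU => i /EM; apply: fg.
have dLL : depends_on M (fun f => L 0 f && L 1 f).
  by move=> f g fg; rewrite (dL 0 f g) // (dL 1 f g).
have feasE a f : feasible r (D :|: E) a f = feasible r D a f && L a f.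
  by rewrite (feasible_join _ _ DE rD wE aDE he0) F2_ex.
have satE s : [disjoint s & coords E] = all (fun i => i.1 \notin edges_in E) s.
  by rewrite disjoint_has -all_predC; apply: eq_all => i; rewrite /= in_coords.
(* Entries of the bridge equation lie outside [coords E], so each one required to vanish costs a
   factor [1 / 2]. *)
pose bits (s : seq (_ * _)) := [seq c q.1 q.2 | q <- s].
have bitsU s : uniq s -> uniq (bits s).
  by rewrite map_inj_uniq // => -[a b] [a' b'] /eqP; rewrite at_edge_inj /= => /andP[/eqP-> /eqP->].
have bitsE s : [disjoint bits s & coords E].
  by rewrite satE all_map; apply/allP => q _; exact: eE.
have pU b s : uniq s -> Pr (fun f => U b f && all (sat^~ f) (bits s)) = sprob C / 2 ^+ size s.
  by move=> Us; rewrite (Pr_all_sat (dU b)) ?bitsU // sC size_map.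
have pUU s : uniq s -> Pr (fun f => (U 0 f && U 1 f) && all (sat^~ f) (bits s))
    = tprob C / 2 ^+ size s.
  by move=> Us; rewrite (Pr_all_sat dUU) ?bitsU // tC size_map.
split=> [a|].
  rewrite (eq_Pr (feasE a)) (Pr_indep (@depends_on_feasible _ _ _) (dL a) DM) sB sprobJ.
  (* Inclusion-exclusion over the value of [w] gives [s / 2 + s / 2 - t / 4]. *)
  congr (_ * _); rewrite Pr_or.
  rewrite (eq_Pr (_ : _ =1 fun f => U 0 f && all (sat^~ f) (bits [:: (a, 0)]))); last first.
    by move=> f; rewrite /= andbT.
  rewrite pU // (eq_Pr (_ : (fun f => U 1 f && sat (c a 1) f)
    =1 fun f => U 1 f && all (sat^~ f) (bits [:: (a, 1)]))); last first.
    by move=> f; rewrite /= andbT.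
  rewrite pU // (eq_Pr (_ : _ =1 fun f => (U 0 f && U 1 f) &&
     all (sat^~ f) (bits [:: (a, 0); (a, 1)]))); last first.
    by move=> f; rewrite /= andbT andbACA.
  rewrite pUU; last by rewrite /= andbT inE xpair_eqE eqxx.
  by rewrite expr1 expr2; field.
rewrite (eq_Pr (_ : _ =1 fun f => (feasible r D 0 f && feasible r D 1 f) && (L 0 f && L 1 f))).
  rewrite (Pr_indep _ dLL DM); last first.
    by move=> f g fg; congr (_ && _); exact: depends_on_feasible.
  rewrite tB tprobJ; congr (_ * _).
  pose V b (s : seq ('F_2 * 'F_2)) f : rat := (U b f && all (sat^~ f) (bits s))%:R.
  pose VV (s : seq ('F_2 * 'F_2)) f : rat := ((U 0 f && U 1 f) && all (sat^~ f) (bits s))%:R.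
  (* Expanding the product of the inclusion-exclusion formulas for [L 0] and [L 1] gives
     [2 s / 4 + 2 t / 4 + t / 16 - 4 t / 8], which is [s / 2 + t / 16]. *)
  transitivity (Ex (fun f =>
      V 0 [:: (0, 0); (1, 0)] f + V 1 [:: (0, 1); (1, 1)] f
    + VV [:: (0, 0); (1, 1)] f + VV [:: (0, 1); (1, 0)] f
    + VV [:: (0, 0); (0, 1); (1, 0); (1, 1)] f
    - VV [:: (0, 0); (1, 0); (1, 1)] f - VV [:: (0, 1); (1, 0); (1, 1)] f
    - VV [:: (0, 0); (0, 1); (1, 0)] f - VV [:: (0, 0); (0, 1); (1, 1)] f)).
    apply: eq_Ex => f; rewrite /L /V /VV /=.
    case: (U 0 f); case: (U 1 f); case: (sat (c 0 0) f); case: (sat (c 0 1) f);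
      by case: (sat (c 1 0) f); case: (sat (c 1 1) f).
  rewrite !(ExB, ExD).
  have pV b s : uniq s -> Ex (V b s) = sprob C / 2 ^+ size s := pU b s.
  have pVV s : uniq s -> Ex (VV s) = tprob C / 2 ^+ size s := pUU s.
  by rewrite 2?pV // 7?pVV //= ; field.
by move=> f; rewrite !feasE andbACA.
Qed.

Lemma q_tree_on A r : tree_on A r [set: G] -> q G = bq A.
Proof.
move=> /Pr_feasible[s1 t1]; rewrite /q -PrE (eq_Pr (consistent_feasible r)).
by rewrite Pr_or !s1 t1 /bq; ring.
Qed.

End Probability.

(** * Comparison of the tree with the star and the path *)

Lemma q_star_graph n : q (star_graph n) = bq (bstar n).
Proof. exact: q_tree_on (star_graph_center n). Qed.

Lemma q_path_graph n : q (path_graph n) = bq (bpath n).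
Proof. exact: q_tree_on (path_graph_end n). Qed.

Theorem theorem14 (n : nat) (T : sgraph) :
  3 <= n ->
  is_tree T ->
  #|edges T| = n ->
  ~ isomorphic T (path_graph n) ->
  ~ isomorphic T (star_graph n) ->
  (q (star_graph n) < q T)%R /\ (q T < q (path_graph n))%R.
Proof.
move=> n3 /tree_ex_tree_on[A [r hA]] edgesT notP notS.
have nA : bsize A = n by rewrite -(card_edge hA).
rewrite q_star_graph q_path_graph (q_tree_on hA) -nA; rewrite -{}nA in n3 notP notS.
have {n3} [B [C eA]] : exists B C, A = Join B C by case: A hA n3 notP notS => // B C; exists B, C.
rewrite !lt_neqAle bq_ge_star (path_max A).2 !andbT; split; apply/eqP.
  rewrite {}eA in hA notS * => /bq_eq_star[]; move: notS hA; rewrite [bsize _]/=.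
  move: (bsize B) (bsize C) => b c notS hA eB eC; rewrite {}eB {}eC in hA.
  (* Equality would make the tree a star, rooted at a leaf if [b = 0] and at its center if
     [c = 0]. *)
  case/orP=> /eqP e0; rewrite {}e0 in notS hA; apply: notS.
    exact: tree_on_isomorphic hA (star_graph_leaf c).
  by rewrite addn0; exact: tree_on_isomorphic hA (star_graph_center b.+1).
rewrite {}eA in hA notP * => /bq_eq_path[]; move: notP hA; rewrite [bsize _]/=.
move: (bsize B) (bsize C) => b c notP hA eB eC; rewrite {}eB {}eC in hA.
exact: notP (tree_on_isomorphic hA (path_graph_inner b c)).
Qed.
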